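(* Let $k$ be a commutative associative unital ring, $R$ a commutative associative unital $k$-algebra that is flat as a $k$-module, $S$ a commutative $R$-algebra that is faithfully flat over $R$, $n\ge 1$, and $B$ an $S/R$-form of $M_n(R)$ (i.e. an $R$-algebra with $B\otimes_R S\cong M_n(S)$ as $S$-algebras). Let $\kappa_B$ be the $R$-bilinear form on $B$ associated to the trace form of $M_n(k)$. (a) $\kappa_B$ is a nonsingular, invariant and $\mathbf{Aut}(B)$-invariant bilinear form and is a basis of the $R$-module $\mathrm{IBF}_R(B)$. (b) $\mathbf{IBF}_R(B)\cong\mathrm{AC}(B)\cong R$, and the map $\mathbf{IBF}_R(B)\to R$, $\overline{b\otimes b'}\mapsto\kappa_B(b,b')$, is an isomorphism of $R$-modules; hence $(B,\kappa_B)$ satisfies the IBF-principle. (c) If $B$ is realized as an $R$-subalgebra of $M_n(S)$ (via $B\cong B\otimes 1\subset B\otimes_R S\cong M_n(S)$), then $\kappa_B$ coincides with the restriction to $B$ of the trace form of $M_n(S)$.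
   Context: For a commutative ring $T$, the trace form of $M_n(T)$ is $(x,y)\mapsto\mathrm{tr}(xy)$. $\kappa_B$ is the unique $R$-bilinear form on $B$ such that $(\kappa_B)_{S'}=\theta^*(\tau_{S'})$ for every faithfully flat commutative $R$-algebra $S'$ and every $S'$-algebra isomorphism $\theta\colon B\otimes_R S'\to M_n(S')$, where $\tau_{S'}$ is the trace form of $M_n(S')$, $\lambda_{S'}$ denotes base change of an $R$-bilinear form ($\lambda_{S'}(x\otimes s,y\otimes s')=\lambda(x,y)ss'$) and $\theta^*(\lambda)(x,y)=\lambda(\theta x,\theta y)$ (such a form exists and is unique). A form $\beta$ on an $R$-algebra $C$ is invariant if $\beta(ab,c)=\beta(a,bc)=\beta(b,ca)$; $\mathbf{Aut}(C)$-invariant if for every commutative $R$-algebra $T$ and every $T$-algebra automorphism $f$ of $C\otimes_R T$, $\beta_T(fx,fy)=\beta_T(x,y)$; nonsingular if $c\mapsto\beta(c,-)$ is a bijection $C\to\mathrm{Hom}_R(C,R)$. $\mathrm{IBF}_R(C)$ is the $R$-module of invariant $R$-bilinear forms $C\times C\to R$ (with $(r\beta)(a,b)=\beta(ra,b)$). $\mathbf{IBF}_R(C)$ is the quotient of $C\otimes_R C$ by the $R$-submodule spanned by all $ab\otimes c-a\otimes bc$ and $ab\otimes c-b\otimes ca$, with $\overline{a\otimes b}$ the class of $a\otimes b$. $\mathrm{AC}(C)=C/\mathrm{ac}(C)$ where $\mathrm{ac}(C)$ is the additive span of all associators $(ab)c-a(bc)$ and all commutators $ab-ba$. $(C,\beta)$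 satisfies the IBF-principle if $\bar\beta\colon\mathbf{IBF}_R(C)\to R$, $\overline{a\otimes b}\mapsto\beta(a,b)$, is an $R$-module isomorphism. *)

(* Defs.v *)
(* Tensor products are given by their universal property
   (MathComp has no tensor products of modules over a commutative ring). *)
From HB Require Import structures.
From mathcomp Require Import all_boot all_order all_algebra.
Set Implicit Arguments. Unset Strict Implicit. Unset Printing Implicit Defensive.
Import GRing.Theory.
Local Open Scope ring_scope.

Section Defs.
Variable R : comPzRingType.

Definition is_linear (M N : lmodType R) (f : M -> N) : Prop :=
  forall (a : R) (x y : M), f (a *: x + y) = a *: f x + f y.

Definition is_bilinear (M N P : lmodType R) (t : M -> N -> P) : Prop :=
  (forall (n : N) (a : R) (m1 m2 : M), t (a *: m1 + m2) n = a *: t m1 n + t m2 n) /\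
  (forall (m : M) (a : R) (n1 n2 : N), t m (a *: n1 + n2) = a *: t m n1 + t m n2).

Definition is_tensor (M N P : lmodType R) (t : M -> N -> P) : Prop :=
  is_bilinear t /\
  forall (Q : lmodType R) (g : M -> N -> Q), is_bilinear g ->
    (exists h : P -> Q, is_linear h /\ forall m n, h (t m n) = g m n) /\
    (forall h1 h2 : P -> Q, is_linear h1 -> is_linear h2 ->
       (forall m n, h1 (t m n) = h2 (t m n)) -> forall p, h1 p = h2 p).

Definition flat (M : lmodType R) : Prop :=
  forall (N N' : lmodType R) (f : N -> N'), is_linear f -> injective f ->
  forall (T T' : lmodType R) (t : N -> M -> T) (t' : N' -> M -> T'),
    is_tensor t -> is_tensor t' ->
    forall h : T -> T', is_linear h -> (forall n m, h (t n m) = t' (f n) m) ->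
      injective h.

Definition faithfully_flat (M : lmodType R) : Prop :=
  flat M /\
  forall (N T : lmodType R) (t : N -> M -> T), is_tensor t ->
    (forall x : T, x = 0) -> forall y : N, y = 0.

Definition bilin_form (C : lmodType R) (beta : C -> C -> R) : Prop :=
  (forall (a : R) (x y z : C), beta (a *: x + y) z = a * beta x z + beta y z) /\
  (forall (a : R) (x y z : C), beta z (a *: x + y) = a * beta z x + beta z y).

Definition invariant_form (C : algType R) (beta : C -> C -> R) : Prop :=
  forall a b c : C, beta (a * b) c = beta a (b * c) /\ beta (a * b) c = beta b (c * a).

Definition nonsingular_form (C : lmodType R) (beta : C -> C -> R) : Prop :=
  (forall c c' : C, (forall x, beta c x = beta c' x) -> c = c') /\
  (forall f : C -> R, (forall (a : R) x y, f (a *: x + y) = a * f x + f y) ->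
     exists c : C, forall x, beta c x = f x).

(* An S-algebra isomorphism theta : B (x)_R S -> M_n(S), where (P,t) is a
   tensor product B (x)_R S.  The S-module and algebra structures of P are
   those determined on pure tensors: s.(b(x)s') = b(x)ss',
   (b(x)s)(b'(x)s') = bb'(x)ss', 1 = 1(x)1. *)
Definition alg_tensor_iso (B : algType R) (S : comAlgType R) (n : nat)
    (P : lmodType R) (t : B -> S -> P) (theta : P -> 'M[S]_n) : Prop :=
  is_tensor t /\ bijective theta /\
  (forall p q, theta (p + q) = theta p + theta q) /\
  (forall b s s', theta (t b (s * s')) = s *: theta (t b s')) /\
  (forall b b' s s', theta (t (b * b') (s * s')) = theta (t b s) *m theta (t b' s')) /\
  theta (t 1 1) = 1%:M.

Definition is_form_of_matrices (B : algType R) (S : comAlgType R) (n : nat) : Prop :=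
  exists (P : lmodType R) (t : B -> S -> P) (theta : P -> 'M[S]_n),
    alg_tensor_iso t theta.

(* The characterising property of kappa_B: (kappa_B)_{S'} = theta^*(tau_{S'})
   for every faithfully flat commutative R-algebra S' and every S'-algebra
   isomorphism theta : B (x)_R S' -> M_n(S'); equality of the S'-bilinear
   forms on B (x)_R S' is tested on pure tensors. *)
Definition is_kappa (B : algType R) (n : nat) (kappa : B -> B -> R) : Prop :=
  bilin_form kappa /\
  forall (S' : comAlgType R), faithfully_flat S' ->
  forall (P : lmodType R) (t : B -> S' -> P) (theta : P -> 'M[S']_n),
    alg_tensor_iso t theta ->
    forall (x y : B) (s s' : S'),
      (kappa x y)%:A * (s * s') = \tr (theta (t x s) *m theta (t y s')).

Definition tensor_act (B : lmodType R) (T : comAlgType R) (P : lmodType R)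
    (t : B -> T -> P) (act : T -> P -> P) : Prop :=
  (forall s p q, act s (p + q) = act s p + act s q) /\
  (forall s b s', act s (t b s') = t b (s * s')).

Definition tensor_mul (B : algType R) (T : comAlgType R) (P : lmodType R)
    (t : B -> T -> P) (mul : P -> P -> P) : Prop :=
  (forall p q r, mul (p + q) r = mul p r + mul q r) /\
  (forall p q r, mul p (q + r) = mul p q + mul p r) /\
  (forall b b' s s', mul (t b s) (t b' s') = t (b * b') (s * s')).

Definition base_change_form (B : lmodType R) (T : comAlgType R) (P : lmodType R)
    (t : B -> T -> P) (beta : B -> B -> R) (kT : P -> P -> T) : Prop :=
  (forall p q r, kT (p + q) r = kT p r + kT q r) /\
  (forall p q r, kT p (q + r) = kT p q + kT p r) /\
  (forall x y s s', kT (t x s) (t y s') = (beta x y)%:A * (s * s')).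

Definition Aut_invariant_form (C : algType R) (beta : C -> C -> R) : Prop :=
  forall (T : comAlgType R) (P : lmodType R) (t : C -> T -> P)
         (act : T -> P -> P) (mul : P -> P -> P) (kT : P -> P -> T),
    is_tensor t -> tensor_act t act -> tensor_mul t mul ->
    base_change_form t beta kT ->
    forall f : P -> P, bijective f ->
      (forall p q, f (p + q) = f p + f q) ->
      (forall s p, f (act s p) = act s (f p)) ->
      (forall p q, f (mul p q) = mul (f p) (f q)) ->
      f (t 1 1) = t 1 1 ->
      forall p q, kT (f p) (f q) = kT p q.

Definition in_Rspan (M : lmodType R) (X : M -> Prop) (x : M) : Prop :=
  forall Q : M -> Prop, Q 0 -> (forall a u v, Q u -> Q v -> Q (a *: u + v)) ->
    (forall y, X y -> Q y) -> Q x.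

Definition in_addspan (M : zmodType) (X : M -> Prop) (x : M) : Prop :=
  forall Q : M -> Prop, Q 0 -> (forall u v, Q u -> Q v -> Q (u - v)) ->
    (forall y, X y -> Q y) -> Q x.

Definition ibf_relations (C : algType R) (P : lmodType R) (t : C -> C -> P)
    (x : P) : Prop :=
  exists a b c : C, x = t (a * b) c - t a (b * c) \/ x = t (a * b) c - t b (c * a).

Definition ac_generators (C : algType R) (x : C) : Prop :=
  (exists a b c : C, x = (a * b) * c - a * (b * c)) \/ (exists a b : C, x = a * b - b * a).

End Defs.

(* Main.v *)
(* Write j : B -> M_n(S) for b |-> theta (b (x) 1). Everything is transported
   along j and descended by one principle: v lies in the span of X as soon as
   v (x) 1 is killed by every map from N (x) S that kills X (x) S. This gives
   in turn that kappa has a finite dual basis in B (descending the Casimir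
   element sum E_qp (x) E_pq), that the centre of B is R, that b |-> kappa 1 b
   is onto R, and that its kernel is the span of the commutators.
   An automorphism of B (x) T extends to one of M_n(T (x) S), so
   Aut(B)-invariance reduces to the fact that automorphisms of a matrix algebra
   over any commutative ring preserve the trace. *)

(* No integer is assumed invertible in [R]: [kappa 1 1] is the image of [n] and may vanish, so
   neither surjectivity nor the kernel of [kappa 1] can come from splitting off the unit. Each
   existence claim over [B] is instead phrased as membership in a submodule, which is the kind of
   statement that descends. The dual basis resists this at first, since its defining identity ranges
   over all of [B]; the Casimir sum is finite, so its second components form a finite generating
   family, and the claim becomes one membership in a finite power of [B]. Descent is tested against
   arbitrary bilinear maps, so it can be applied with whichever model [P] of the tensor product
   carries [theta]. Over a general commutative ring an automorphism of a matrix algebra need not be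
   inner, so conjugation invariance does not give trace preservation; a computation with the image
   of one rank-one idempotent does. *)
Require Import Defs.
From HB Require Import structures.
From mathcomp Require Import all_boot all_order all_algebra.
From mathcomp Require Import boolp.
Set Implicit Arguments. Unset Strict Implicit. Unset Printing Implicit Defensive.
Import GRing.Theory.
Local Open Scope ring_scope.
Local Open Scope quotient_scope.

(** * Quotients and tensor products *)

Lemma morphD0 (U V : zmodType) (f : U -> V) : {morph f : x y / x + y} -> f 0 = 0.
Proof. by move=> fD; apply: (addIr (f 0)); rewrite -fD !add0r. Qed.

Section Linear.
Variable R : comPzRingType.

Lemma is_linear0 (M N : lmodType R) (f : M -> N) : is_linear f -> f 0 = 0.
Proof. by move=> lf; apply: morphD0 => x y; rewrite -[x]scale1r lf !scale1r. Qed.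

Lemma is_linearD (M N : lmodType R) (f : M -> N) :
  is_linear f -> {morph f : x y / x + y}.
Proof. by move=> lf x y; rewrite -[x]scale1r lf !scale1r. Qed.

Lemma is_linearZ (M N : lmodType R) (f : M -> N) :
  is_linear f -> forall a, {morph f : x / a *: x}.
Proof. by move=> lf a x; rewrite -[a *: x]addr0 lf (is_linear0 lf) addr0. Qed.

Lemma is_linearB (M N : lmodType R) (f : M -> N) :
  is_linear f -> {morph f : x y / x - y}.
Proof. by move=> lf x y; rewrite addrC -scaleN1r lf scaleN1r addrC. Qed.

Lemma is_linear_sum (M N : lmodType R) (f : M -> N) : is_linear f ->
  forall I (r : seq I) (p : pred I) (F : I -> M),
  f (\sum_(i <- r | p i) F i) = \sum_(i <- r | p i) f (F i).
Proof. by move=> lf I r p F; apply: (big_morph f (is_linearD lf) (is_linear0 lf)). Qed.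

Lemma bilinear_lin_l (M N Q : lmodType R) (g : M -> N -> Q) n :
  is_bilinear g -> is_linear (g^~ n).
Proof. by case=> gl _ a x y; apply: gl. Qed.

Lemma bilinear_lin_r (M N Q : lmodType R) (g : M -> N -> Q) m :
  is_bilinear g -> is_linear (g m).
Proof. by case=> _ gr a x y; apply: gr. Qed.

Lemma is_bilinearP (M N Q : lmodType R) (g : M -> N -> Q) :
  (forall n, is_linear (g^~ n)) -> (forall m, is_linear (g m)) -> is_bilinear g.
Proof. by move=> gl gr; split=> [n a x y | m a x y]; [apply: gl | apply: gr]. Qed.

End Linear.

Section Span.
Variables (R : comPzRingType) (M : lmodType R) (X : M -> Prop).

Lemma in_Rspan0 : in_Rspan X 0.
Proof. by move=> Q. Qed.

Lemma in_Rspan_gen x : X x -> in_Rspan X x.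
Proof. by move=> Xx Q _ _ XQ; apply: XQ. Qed.

Lemma in_RspanP a x y : in_Rspan X x -> in_Rspan X y -> in_Rspan X (a *: x + y).
Proof. by move=> Xx Xy Q Q0 QP QX; exact: QP (Xx Q Q0 QP QX) (Xy Q Q0 QP QX). Qed.

Lemma in_RspanD x y : in_Rspan X x -> in_Rspan X y -> in_Rspan X (x + y).
Proof. by rewrite -{2}[x]scale1r; apply: in_RspanP. Qed.

Lemma in_RspanZ a x : in_Rspan X x -> in_Rspan X (a *: x).
Proof.
by move=> Xx; rewrite -[a *: x]addr0; apply: in_RspanP => //; apply: in_Rspan0.
Qed.

Lemma in_RspanN x : in_Rspan X x -> in_Rspan X (- x).
Proof. by rewrite -scaleN1r; apply: in_RspanZ. Qed.

Lemma in_Rspan_ind (Y : M -> Prop) : Y 0 ->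
  (forall a u v, Y u -> Y v -> Y (a *: u + v)) -> (forall y, X y -> Y y) ->
  forall x, in_Rspan X x -> Y x.
Proof. by move=> Y0 YP XY x Xx; exact: (Xx Y). Qed.

Definition quomod_rel (x y : M) : bool := `[< in_Rspan X (x - y) >].

Lemma quomod_equiv : equiv_class_of quomod_rel.
Proof.
split=> [x | x y | y x z].
- by apply/asboolP; rewrite subrr; apply: in_Rspan0.
- by apply/asboolP/asboolP => /in_RspanN; rewrite opprB.
- move=> /asboolP xy /asboolP yz; apply/asboolP.
  by rewrite -[x](subrK y) -addrA; apply: in_RspanD.
Qed.

Canonical quomod_equiv_rel := EquivRelPack quomod_equiv.
Definition quomod := {eq_quot quomod_rel}.
HB.instance Definition _ := Choice.on quomod.

Definition quopi (x : M) : quomod := \pi_{eq_quot quomod_rel} x.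
Definition quorep (q : quomod) : M := repr (q : {eq_quot quomod_rel}).

Lemma quorepK : cancel quorep quopi.
Proof. exact: reprK. Qed.

Lemma quopiP x y : quopi x = quopi y <-> in_Rspan X (x - y).
Proof.
split=> [e | e]; first by apply/asboolP; apply/(eqmodP quomod_equiv_rel).
by apply/(eqmodP quomod_equiv_rel); apply/asboolP.
Qed.

Lemma quorep_mod x : in_Rspan X (quorep (quopi x) - x).
Proof. by apply/quopiP; rewrite quorepK. Qed.

Definition quo_add p q := quopi (quorep p + quorep q).
Definition quo_opp p := quopi (- quorep p).
Definition quo_scale a p := quopi (a *: quorep p).

Lemma quopi_add x y : quo_add (quopi x) (quopi y) = quopi (x + y).
Proof. by apply/quopiP; rewrite opprD addrACA; apply: in_RspanD; apply: quorep_mod. Qed.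

Lemma quopi_opp x : quo_opp (quopi x) = quopi (- x).
Proof. by apply/quopiP; rewrite -opprD; apply: in_RspanN; apply: quorep_mod. Qed.

Lemma quopi_scale a x : quo_scale a (quopi x) = quopi (a *: x).
Proof. by apply/quopiP; rewrite -scalerBr; apply: in_RspanZ; apply: quorep_mod. Qed.

Fact quo_addA : associative quo_add.
Proof.
move=> p q r; rewrite -(quorepK p) -(quorepK q) -(quorepK r).
by rewrite !quopi_add addrA.
Qed.

Fact quo_addC : commutative quo_add.
Proof. by move=> p q; rewrite /quo_add addrC. Qed.

Fact quo_add0 : left_id (quopi 0) quo_add.
Proof. by move=> p; rewrite -(quorepK p) quopi_add add0r. Qed.

Fact quo_addN : left_inverse (quopi 0) quo_opp quo_add.
Proof. by move=> p; rewrite -(quorepK p) quopi_opp quopi_add addNr. Qed.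

HB.instance Definition _ :=
  GRing.isZmodule.Build quomod quo_addA quo_addC quo_add0 quo_addN.

Fact quo_scaleA a b p : quo_scale a (quo_scale b p) = quo_scale (a * b) p.
Proof. by rewrite -(quorepK p) !quopi_scale scalerA. Qed.

Fact quo_scale1 : left_id 1 quo_scale.
Proof. by move=> p; rewrite -(quorepK p) quopi_scale scale1r. Qed.

Fact quo_scaleDr : right_distributive quo_scale +%R.
Proof.
move=> a p q; rewrite -(quorepK p) -(quorepK q).
by rewrite [quopi _ + quopi _]quopi_add !quopi_scale [RHS]quopi_add scalerDr.
Qed.

Fact quo_scaleDl p : {morph quo_scale^~ p : a b / a + b}.
Proof.
move=> a b; rewrite -(quorepK p) !quopi_scale.
by rewrite [RHS]quopi_add scalerDl.
Qed.

HB.instance Definition _ := GRing.Zmodule_isLmodule.Build R quomod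
  quo_scaleA quo_scale1 quo_scaleDr quo_scaleDl.

Lemma quopi_linear : is_linear (quopi : M -> quomod).
Proof. by move=> a x y; rewrite -quopi_add -quopi_scale. Qed.

Lemma quopi_eq0 x : quopi x = 0 <-> in_Rspan X x.
Proof. by rewrite -{2}[x]subr0; apply: quopiP. Qed.

End Span.

Section Tensor.
Variables (R : comPzRingType) (M N : lmodType R).

Definition bilin_eval (Q : lmodType R) (g : M -> N -> Q) (l : seq (M * N)) : Q :=
  \sum_(x <- l) g x.1 x.2.

(* Two formal sums of pairs are identified when no bilinear map separates them;
   this gives the tensor product without passing through a free module. *)
Definition tens_rel (l1 l2 : seq (M * N)) : bool :=
  `[< forall (Q : lmodType R) (g : M -> N -> Q),
      is_bilinear g -> bilin_eval g l1 = bilin_eval g l2 >].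

Lemma tens_equiv : equiv_class_of tens_rel.
Proof.
split=> [x | x y | y x z].
- by apply/asboolP.
- by apply/asboolP/asboolP => H Q g bg; rewrite H.
- by move=> /asboolP xy /asboolP yz; apply/asboolP => Q g bg; rewrite xy // yz.
Qed.

Canonical tens_equiv_rel := EquivRelPack tens_equiv.
Definition tens := {eq_quot tens_rel}.
HB.instance Definition _ := Choice.on tens.

Definition tpi (x : seq (M * N)) : tens := \pi_{eq_quot tens_rel} x.
Definition trep (q : tens) : seq (M * N) := repr (q : {eq_quot tens_rel}).

Lemma trepK : cancel trep tpi.
Proof. exact: reprK. Qed.

Lemma tpiP x y : tpi x = tpi y <-> (forall (Q : lmodType R) (g : M -> N -> Q),
      is_bilinear g -> bilin_eval g x = bilin_eval g y).
Proof.
split=> [e | e]; first by apply/asboolP; apply/(eqmodP tens_equiv_rel).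
by apply/(eqmodP tens_equiv_rel); apply/asboolP.
Qed.

Lemma bilin_eval_rep (Q : lmodType R) (g : M -> N -> Q) x :
  is_bilinear g -> bilin_eval g (trep (tpi x)) = bilin_eval g x.
Proof. by move=> bg; apply: (iffLR (tpiP _ _)) => //; rewrite trepK. Qed.

Let sc a (l : seq (M * N)) := [seq (a *: x.1, x.2) | x <- l].

Lemma bilin_eval_scale (Q : lmodType R) (g : M -> N -> Q) a l :
  is_bilinear g -> bilin_eval g (sc a l) = a *: bilin_eval g l.
Proof.
move=> bg; rewrite /bilin_eval big_map scaler_sumr; apply: eq_bigr => x _ /=.
exact: (is_linearZ (bilinear_lin_l x.2 bg)).
Qed.

Lemma bilin_eval_cat (Q : lmodType R) (g : M -> N -> Q) l1 l2 :
  bilin_eval g (l1 ++ l2) = bilin_eval g l1 + bilin_eval g l2.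
Proof. by rewrite /bilin_eval big_cat. Qed.

Definition tens_add p q := tpi (trep p ++ trep q).
Definition tens_scale a p := tpi (sc a (trep p)).
Definition tens_opp p := tens_scale (- 1) p.

Let bE := (bilin_eval_cat, bilin_eval_scale, bilin_eval_rep).

Fact tens_addA : associative tens_add.
Proof. by move=> p q r; apply/tpiP => Q g bg; rewrite !bE // addrA. Qed.

Fact tens_addC : commutative tens_add.
Proof. by move=> p q; apply/tpiP => Q g bg; rewrite !bE // addrC. Qed.

Fact tens_add0 : left_id (tpi [::]) tens_add.
Proof.
move=> p; rewrite -[RHS]trepK; apply/tpiP => Q g bg.
by rewrite !bE // /bilin_eval big_nil add0r.
Qed.

Fact tens_addN : left_inverse (tpi [::]) tens_opp tens_add.
Proof.
move=> p; apply/tpiP => Q g bg.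
by rewrite !bE // scaleN1r addNr /bilin_eval big_nil.
Qed.

HB.instance Definition _ :=
  GRing.isZmodule.Build tens tens_addA tens_addC tens_add0 tens_addN.

Fact tens_scaleA a b p : tens_scale a (tens_scale b p) = tens_scale (a * b) p.
Proof. by apply/tpiP => Q g bg; rewrite !bE // scalerA. Qed.

Fact tens_scale1 : left_id 1 tens_scale.
Proof.
by move=> p; rewrite -[RHS]trepK; apply/tpiP => Q g bg; rewrite !bE // scale1r.
Qed.

Fact tens_scaleDr : right_distributive tens_scale +%R.
Proof. by move=> a p q; apply/tpiP => Q g bg; rewrite !bE // scalerDr. Qed.

Fact tens_scaleDl p : {morph tens_scale^~ p : a b / a + b}.
Proof. by move=> a b; apply/tpiP => Q g bg; rewrite !bE // scalerDl. Qed.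

HB.instance Definition _ := GRing.Zmodule_isLmodule.Build R tens
  tens_scaleA tens_scale1 tens_scaleDr tens_scaleDl.

Definition tens_pure (m : M) (n : N) : tens := tpi [:: (m, n)].

(** Defined for every [g], by evaluation on the chosen representative; bilinearity enters only to
    show that the result does not depend on that choice. *)
Definition tens_lift (Q : lmodType R) (g : M -> N -> Q) (p : tens) : Q :=
  bilin_eval g (trep p).

Let ev1 (Q : lmodType R) (g : M -> N -> Q) m n : bilin_eval g [:: (m, n)] = g m n.
Proof. by rewrite /bilin_eval big_seq1. Qed.

Lemma tens_pure_bilinear : is_bilinear tens_pure.
Proof.
split=> [n a m1 m2 | m a n1 n2]; apply/tpiP => Q g bg; rewrite !bE // !ev1.
  exact: (bilinear_lin_l _ bg).
exact: (bilinear_lin_r _ bg).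
Qed.

Lemma tens_lift_linear (Q : lmodType R) (g : M -> N -> Q) :
  is_bilinear g -> is_linear (tens_lift g).
Proof. by move=> bg a p q; rewrite /tens_lift !bE. Qed.

Lemma tens_lift_pure (Q : lmodType R) (g : M -> N -> Q) m n :
  is_bilinear g -> tens_lift g (tens_pure m n) = g m n.
Proof. by move=> bg; rewrite /tens_lift bE // ev1. Qed.

Lemma tens_sum_pure p : exists l, p = \sum_(x <- l) tens_pure x.1 x.2.
Proof.
exists (trep p); rewrite -{1}[p]trepK; elim: (trep p) => [|[m n] l IH].
  by rewrite big_nil.
rewrite big_cons -IH; apply/tpiP => Q g bg.
by rewrite !bE // -bilin_eval_cat.
Qed.

Lemma tens_is_tensor : is_tensor tens_pure.
Proof.
split=> [|Q g bg]; first exact: tens_pure_bilinear.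
split=> [|h1 h2 l1 l2 e p].
  exists (tens_lift g); split; first exact: tens_lift_linear.
  by move=> m n; apply: tens_lift_pure.
have [l ->] := tens_sum_pure p.
by rewrite !is_linear_sum //; apply: eq_bigr => x _.
Qed.

End Tensor.

(** Generation by pure tensors is clear in the model [tens]. It passes to any [P] because the
    composite of the comparison maps from [P] to [tens] and back fixes all [t m n], hence is the
    identity by uniqueness. *)
Lemma tensor_sum (R : comPzRingType) (M N P : lmodType R) (t : M -> N -> P) :
  is_tensor t -> forall p, exists l, p = \sum_(x <- l) t x.1 x.2.
Proof.
move=> [bt ut] p.
have [[h [lh hE]] _] := ut _ _ (tens_pure_bilinear M N).
have lg := tens_lift_linear bt.
have [_ /(_ (fun p => tens_lift t (h p)) id) uniq] := ut _ _ bt.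
have <- : tens_lift t (h p) = p.
  apply: uniq => [a x y | // | m n]; first by rewrite lh lg.
  by rewrite hE tens_lift_pure.
have [l ->] := tens_sum_pure (h p); exists l.
by rewrite (is_linear_sum lg); apply: eq_bigr => x _; apply: tens_lift_pure.
Qed.

Lemma tensor_ind (R : comPzRingType) (M N P : lmodType R) (t : M -> N -> P)
    (Y : P -> Prop) : is_tensor t -> Y 0 ->
  (forall p q, Y p -> Y q -> Y (p + q)) -> (forall m n, Y (t m n)) ->
  forall p, Y p.
Proof.
move=> tt Y0 YD Yt p; have [l ->] := tensor_sum tt p.
by apply: big_ind => // x _.
Qed.

(* The cyclic submodule generated by the class of [v] in [N/<X>] is realised as
   [R/I], with [I] the annihilator of that class: it stays injective after
   tensoring with [S], while its image there is zero. *)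
Lemma faithfully_flat_span (R : comPzRingType) (S : comAlgType R)
    (N : lmodType R) (X : N -> Prop) (v : N) :
  faithfully_flat S ->
  (forall (Q : lmodType R) (g : N -> S -> Q), is_bilinear g ->
     (forall x, X x -> forall s, g x s = 0) -> g v 1 = 0) ->
  in_Rspan X v.
Proof.
move=> [flatS faithS] vX.
pose M : lmodType R := quomod X; pose pi : N -> M := quopi X.
have lpi : is_linear pi by exact: quopi_linear.
pose I (r : R^o) := (r : R) *: pi v = 0.
pose L : lmodType R := quomod I.
pose f (l : L) : M := (quorep l : R) *: pi v.
have inI r : in_Rspan I r -> (r : R) *: pi v = 0.
  apply: (in_Rspan_ind (Y := fun r : R^o => (r : R) *: pi v = 0)) => //.
    by rewrite scale0r.
  by move=> a x y x0 y0; rewrite scalerDl -scalerA x0 y0 scaler0 addr0.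
have fpi (r : R^o) : f (quopi I r) = (r : R) *: pi v.
  apply/eqP; rewrite -subr_eq0 -scalerBl; apply/eqP/inI.
  exact: quorep_mod.
have lf : is_linear f.
  move=> a p q; rewrite -(quorepK p) -(quorepK q).
  rewrite -[_ + _](quopi_linear I) !fpi.
  by rewrite scalerDl -scalerA.
have injf : injective f.
  move=> p q; rewrite -(quorepK p) -(quorepK q) !fpi => e.
  apply/quopiP; apply: (@in_Rspan_gen _ _ I).
  apply: (etrans (@scalerBl R M (quorep p) (quorep q) (pi v))).
  by rewrite e subrr.
have [tL tM] := (tens_is_tensor L S, tens_is_tensor M S).
have bg : is_bilinear (fun (l : L) (s : S) => tens_pure (f l) s).
  apply: is_bilinearP => [s a x y | l].
    by rewrite lf (bilinear_lin_l s (tens_pure_bilinear M S)).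
  exact: bilinear_lin_r (tens_pure_bilinear M S).
have [[h [lh hE]] _] := tL.2 _ _ bg.
(* The hypothesis only pairs [v] with 1; absorbing the factor [s] into the bilinear map yields the
   vanishing for every [s]. *)
have vs0 (s : S) : tens_pure (pi v) s = 0.
  rewrite -[s]mulr1.
  apply: (vX _ (fun x s' => tens_pure (pi x) (s * s'))).
    apply: is_bilinearP => [s' a x y | x a s1 s2].
      by rewrite lpi (bilinear_lin_l _ (tens_pure_bilinear M S)).
    by rewrite mulrDr -scalerAr (bilinear_lin_r _ (tens_pure_bilinear M S)).
  move=> x Xx s'; have -> : pi x = 0 by apply/quopi_eq0; apply: in_Rspan_gen.
  exact: is_linear0 (bilinear_lin_l _ (tens_pure_bilinear M S)).
have h0 x : h x = 0.
  apply: (tensor_ind (Y := fun x => h x = 0) tL); first exact: is_linear0.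
    by move=> p q hp hq; rewrite is_linearD // hp hq addr0.
  move=> l s; rewrite hE (is_linearZ (bilinear_lin_l s (tens_pure_bilinear M S))).
  by rewrite vs0 scaler0.
have T0 (x : tens L S) : x = 0.
  by apply: (flatS _ _ f lf injf _ _ _ _ tL tM h lh hE); rewrite !h0.
have /(_ (quopi I (1 : R^o))) L0 := faithS _ _ _ tL T0.
apply/quopi_eq0; change (pi v = 0); rewrite -[pi v]scale1r -(fpi 1).
by rewrite L0 (is_linear0 lf).
Qed.

(** * The tensor product of two commutative algebras as a ring *)

Section TensorAlgebra.
Variables (R : comPzRingType) (T S : comAlgType R).
Implicit Types p q r : tens T S.

Let bp := tens_pure_bilinear T S.

Let mul_pure (t : T) (s : S) (t' : T) (s' : S) := tens_pure (t * t') (s * s').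

Lemma mul_pure_bilinear t s : is_bilinear (mul_pure t s).
Proof.
apply: is_bilinearP => [s' a x y | t' a x y]; rewrite /mul_pure mulrDr -scalerAr.
  exact: (bilinear_lin_l _ bp).
exact: (bilinear_lin_r _ bp).
Qed.

Definition tens_mul p q : tens T S :=
  tens_lift (fun t s => tens_lift (mul_pure t s) q) p.

Lemma tens_mul_bilinear q :
  is_bilinear (fun t s => tens_lift (mul_pure t s) q).
Proof.
(* All lifts here are evaluated on the same representative of [q], so a pointwise linear relation
   between the integrands passes to the lifts. *)
have lq (h1 h2 h3 : T -> S -> tens T S) a :
    (forall t s, h1 t s = a *: h2 t s + h3 t s) ->
    tens_lift h1 q = a *: tens_lift h2 q + tens_lift h3 q.
  move=> e; rewrite /tens_lift /bilin_eval scaler_sumr -big_split /=.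
  by apply: eq_bigr => x _; rewrite e.
apply: is_bilinearP => [s a x y | t a x y]; apply: lq => t' s'; rewrite /mul_pure.
  by rewrite mulrDl -scalerAl (bilinear_lin_l _ bp).
by rewrite mulrDl -scalerAl (bilinear_lin_r _ bp).
Qed.

Lemma tens_mul_linl q : is_linear (tens_mul^~ q).
Proof. exact: (tens_lift_linear (tens_mul_bilinear q)). Qed.

Lemma tens_mul_pure t s t' s' :
  tens_mul (tens_pure t s) (tens_pure t' s') = tens_pure (t * t') (s * s').
Proof.
rewrite /tens_mul tens_lift_pure; last exact: tens_mul_bilinear.
by rewrite tens_lift_pure //; apply: mul_pure_bilinear.
Qed.

Fact tens_mulDl : left_distributive tens_mul +%R.
Proof. by move=> p q r; rewrite (is_linearD (tens_mul_linl r)). Qed.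

Fact tens_mulC : commutative tens_mul.
Proof.
(* Linearity in the right factor is so far available only when the left factor is pure. This is
   enough to expand both factors, and commutativity then supplies right distributivity. *)
have mulrl t s : is_linear (tens_mul (tens_pure t s)).
  move=> a x y; rewrite /tens_mul !tens_lift_pure; try exact: tens_mul_bilinear.
  by rewrite (tens_lift_linear (mul_pure_bilinear t s)).
move=> p q; have [l ->] := tens_sum_pure p; have [l' ->] := tens_sum_pure q.
rewrite !(is_linear_sum (tens_mul_linl _)).
under eq_bigr do rewrite (is_linear_sum (mulrl _ _)).
rewrite exchange_big /=; apply: eq_bigr => y _.
rewrite (is_linear_sum (mulrl _ _)); apply: eq_bigr => x _.
by rewrite !tens_mul_pure mulrC [_.2 * _]mulrC.
Qed.

Fact tens_mulDr : right_distributive tens_mul +%R.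
Proof. by move=> p q r; rewrite tens_mulC tens_mulDl ![tens_mul _ p]tens_mulC. Qed.

Fact tens_mul1 : left_id (tens_pure 1 1) tens_mul.
Proof.
apply: (tensor_ind (tens_is_tensor T S)) => [|p q ep eq|t s].
- by rewrite tens_mulC (is_linear0 (tens_mul_linl _)).
- by rewrite tens_mulDr ep eq.
- by rewrite tens_mul_pure !mul1r.
Qed.

Fact tens_mulA : associative tens_mul.
Proof.
have m0 p : tens_mul 0 p = 0 by exact: (is_linear0 (tens_mul_linl p)).
move=> p q r; move: p.
apply: (tensor_ind (tens_is_tensor T S)) => [|p p' ep ep'|t s].
- by rewrite !m0.
- by rewrite !tens_mulDl ep ep'.
move: q; apply: (tensor_ind (tens_is_tensor T S)) => [|p p' ep ep'|t' s'].
- by rewrite m0 ![tens_mul (tens_pure t s) _]tens_mulC !m0.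
- by rewrite tens_mulDl !tens_mulDr ep ep' -tens_mulDl.
move: r; apply: (tensor_ind (tens_is_tensor T S)) => [|p p' ep ep'|t'' s''].
- by rewrite ![tens_mul _ 0]tens_mulC !m0 tens_mulC m0.
- by rewrite !tens_mulDr ep ep'.
by rewrite !tens_mul_pure !mulrA.
Qed.

HB.instance Definition _ := GRing.Zmodule_isComPzRing.Build (tens T S)
  tens_mulA tens_mulC tens_mul1 tens_mulDl.

Lemma tens_pureM t s t' s' :
  tens_pure t s * tens_pure t' s' = tens_pure (t * t') (s * s') :> tens T S.
Proof. exact: tens_mul_pure. Qed.

End TensorAlgebra.

(** * Automorphisms and traces on matrix algebras *)

Section MatrixAutomorphism.
Variables (A : comPzRingType).

Lemma delta_mx_mul_delta m n p q (X : 'M[A]_(n, p)) (i : 'I_m) j k (l : 'I_q) :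
  delta_mx i j *m X *m delta_mx k l = X j k *: delta_mx i l.
Proof.
(* Each matrix unit is split as a column times a row through a one-element index set, so that the
   middle product is a 1 by 1 matrix, that is, a scalar. *)
rewrite -(mul_delta_mx (0 : 'I_1) i j) -(mul_delta_mx (0 : 'I_1) k l).
rewrite -!mulmxA (mulmxA _ X) -rowE (mulmxA (row j X)) -colE.
by rewrite [col k _]mx11_scalar mul_scalar_mx -scalemxAr mul_delta_mx !mxE.
Qed.

Lemma mxtrace_delta_mul n (X : 'M[A]_n) i j : \tr (delta_mx i j *m X) = X j i.
Proof.
rewrite /mxtrace (bigD1 i) //= big1 ?addr0 => [|k nki].
  rewrite !mxE (bigD1 j) //= big1 ?addr0 => [|l nlj]; first by rewrite !mxE !eqxx mul1r.
  by rewrite mxE (negPf nlj) andbF mul0r.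
by rewrite !mxE big1 // => l _; rewrite mxE (negPf nki) mul0r.
Qed.

(** Induction on [r]: in the binomial expansion of the power [k.+1] of [x + F i], terms with at
    least two factors [F i] are killed by [d], and the other two contain [x ^+ k]. It serves to pass
    from the diagonal entries of a matrix to its trace. *)
Lemma nil_ann_sum (d : A) (I : Type) (r : seq I) (F : I -> A) :
  (forall i, d * F i ^+ 2 = 0) -> exists k, d * (\sum_(i <- r) F i) ^+ k = 0.
Proof.
move=> dF; elim: r => [|i r [k IH]]; first by exists 1%N; rewrite big_nil mulr0.
exists k.+1; rewrite big_cons addrC; set x := \sum_(_ <- _) _ in IH *.
rewrite exprDn big_distrr /= big1 // => -[[|[|j]] lej] _ /=.
- by rewrite subn0 expr0 mulr1 bin0 mulr1n exprSr mulrA IH mul0r.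
- by rewrite subn1 mulrnAr /= mulrA IH mul0r mul0rn.
- rewrite mulrnAr -(addn2 j) exprD; have := dF i.
  move: (F i ^+ 2) (F i ^+ j) (x ^+ _) => u v y du.
  by rewrite [v * u]mulrC (mulrCA y) (mulrA d) du mul0r mul0rn.
Qed.

(* With [F = f E_00], [e = \tr F] and [c p q = (f^-1 E_pq)_00], linearity over
   [A] forces [F E_pq F = c p q F], i.e. [F a p * F q b = c p q * F a b] and
   [F q p = c p q * e]. Hence [e^2 = 1] and [(1 - e) F_aa^2 = 0], so [1 - e]
   kills a power of [e]. *)
Lemma mxtrace_automorphism n (f : 'M[A]_n -> 'M[A]_n) :
  is_linear f -> bijective f -> (forall X Y, f (X *m Y) = f X *m f Y) ->
  forall X, \tr (f X) = \tr X.
Proof.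
case: n f => [|n] f lf [g fK gK] fM X; first by rewrite /mxtrace !big_ord0.
have lg : is_linear g.
  by move=> a x y; apply: (can_inj fK); rewrite lf !gK.
pose F := f (delta_mx 0 0); pose e := \tr F.
(* Cyclicity of the trace, applied after factoring the matrix unit through index 0, leaves [e] as
   the only unknown. *)
have tr_delta i j : \tr (f (delta_mx i j)) = (i == j)%:R * e.
  have -> : delta_mx i j = delta_mx i 0 *m delta_mx (0 : 'I_n.+1) j :> 'M[A]_n.+1.
    by rewrite mul_delta_mx.
  rewrite fM mxtrace_mulC -fM mul_delta_mx_cond eq_sym.
  by case: eqP => _; rewrite ?mulr1n ?mul1r // mulr0n mul0r is_linear0 // mxtrace0.
suff e1 : e = 1.
  rewrite {1}[X]matrix_sum_delta (is_linear_sum lf) raddf_sum /mxtrace.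
  apply: eq_bigr => i _; rewrite -/(mxtrace _) (is_linear_sum lf) raddf_sum.
  rewrite (bigD1 i) //= big1 ?addr0 => [|j nji];
    rewrite is_linearZ // mxtraceZ tr_delta e1 mulr1 ?eqxx ?mulr1 //.
  by rewrite eq_sym (negPf nji) mulr0.
pose c p q := g (delta_mx p q) 0 0.
have FFM M : F *m M *m F = (g M) 0 0 *: F.
  rewrite -{1}[M]gK -!fM -is_linearZ //; congr f.
  exact: delta_mx_mul_delta.
have Fc a p q b : F a p * F q b = c p q * F a b.
  have /matrixP/(_ a b) := FFM (delta_mx p q); rewrite [RHS]mxE => <-.
  rewrite -(mul_delta_mx (0 : 'I_1)) mulmxA -colE -mulmxA -rowE.
  by rewrite mxE big_ord1 !mxE.
have FF : F *m F = F by rewrite -fM mul_delta_mx.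
have Fce q p : F q p = c p q * e.
  rewrite -(mxtraceZ (c p q)) -FFM mxtrace_mulC mulmxA FF mxtrace_mulC.
  by rewrite mxtrace_delta_mul.
(* Apply [g] to the expansion of [F] in matrix units and read off the entry at (0, 0), using that
   [g F] is the unit [delta_mx 0 0]. *)
have cF : \sum_p \sum_q F p q * c p q = 1.
  have -> : 1 = g F 0 0 by rewrite fK mxE !eqxx.
  rewrite [F in g F]matrix_sum_delta (is_linear_sum lg) summxE.
  apply: eq_bigr => p _; rewrite (is_linear_sum lg) summxE.
  by apply: eq_bigr => q _; rewrite is_linearZ // mxE.
have e2 : e * e = 1.
  rewrite -cF {1}/e /mxtrace mulr_suml; apply: eq_bigr => p _.
  by rewrite /e /mxtrace mulr_sumr; apply: eq_bigr => q _; rewrite Fc mulrC.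
(* The square of [F a a] equals [c a a * F a a] by [Fc] and [c a a * e * F a a] by [Fce], so
   multiplying it by [e] changes nothing. *)
have dF a : (1 - e) * F a a ^+ 2 = 0.
  rewrite mulrBl mul1r expr2 {1}Fce Fc -mulrA [e * F a a]mulrC.
  by rewrite [e * _]mulrC -mulrA subrr.
have [k] := nil_ann_sum (index_enum 'I_n.+1) dF.
rewrite -/(mxtrace F) -/e => ek; apply/esym/eqP; rewrite -subr_eq0; apply/eqP.
rewrite -[RHS](mul0r (e ^+ k)) -[in RHS]ek.
by rewrite -mulrA -exprMn e2 expr1n mulr1.
Qed.

End MatrixAutomorphism.

(** Modulo commutators [a *: delta_mx i j] is zero off the diagonal and [a *: delta_mx 0 0] on it,
    so [H X] depends only on the trace. As [H] is merely additive, the scalar has to stay inside its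
    argument. *)
Lemma mxtrace_universal (A : comPzRingType) n (Q : zmodType) (H : 'M[A]_n -> Q) :
  {morph H : X Y / X + Y} -> (forall X Y, H (X *m Y) = H (Y *m X)) ->
  forall X, \tr X = 0 -> H X = 0.
Proof.
case: n H => [|n] H HD HC X trX.
  by apply: (addIr (H X)); rewrite add0r -HD [X]flatmx0 addr0.
have H0 := morphD0 HD.
pose E := delta_mx 0 0 : 'M[A]_n.+1.
have Hd a i j : H (a *: delta_mx i j) = if i == j then H (a *: E) else 0.
  have <- : a *: delta_mx i (0 : 'I_n.+1) *m delta_mx 0 j =
      a *: delta_mx i j :> 'M[A]_n.+1.
    by rewrite -scalemxAl mul_delta_mx.
  rewrite HC -scalemxAr mul_delta_mx_cond eq_sym.
  by case: eqP => _; rewrite ?mulr1n // mulr0n scaler0.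
transitivity (H (\tr X *: E)); last by rewrite trX scale0r.
rewrite [X in LHS]matrix_sum_delta (big_morph H HD H0) /mxtrace scaler_suml.
rewrite (big_morph H HD H0); apply: eq_bigr => i _.
rewrite (big_morph H HD H0) (bigD1 i) //= big1 ?addr0 => [|j nji]; rewrite Hd.
  by rewrite eqxx.
by rewrite eq_sym (negPf nji).
Qed.

Lemma central_mx_scalar (A : pzRingType) n (i0 : 'I_n) (X : 'M[A]_n) :
  (forall Y, X *m Y = Y *m X) -> X = (X i0 i0)%:M.
Proof.
move=> XC; apply/matrixP => i j; rewrite mxE.
(* Commuting with this matrix unit carries entry [X i0 i0] to position [i] of the diagonal and kills
   the rest of row [i]. *)
have /matrixP/(_ i0 j) := XC (delta_mx i0 i).
rewrite !mxE (bigD1 i0) //= big1 ?addr0 => [|k nk]; last first.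
  by rewrite mxE (negPf nk) mulr0.
rewrite (bigD1 i) //= big1 ?addr0 => [|k nk]; last first.
  by rewrite mxE (negPf nk) andbF mul0r.
rewrite !mxE !eqxx /= mul1r => <-; rewrite eq_sym.
by case: eqP; rewrite ?mulr1 ?mulr0.
Qed.

(** * Descent of the trace form *)

Section Form.
Variables (R : comPzRingType) (S : comAlgType R) (n : nat) (B : algType R).
Variables (P : lmodType R) (t : B -> S -> P) (theta : P -> 'M[S]_n).
Hypothesis hform : alg_tensor_iso t theta.

Let tt : is_tensor t := hform.1.
Let bt : is_bilinear t := tt.1.

Definition form_emb (b : B) : 'M[S]_n := theta (t b 1).
Local Notation j := form_emb.

Lemma thetaD : {morph theta : p q / p + q}.
Proof. by case: hform => _ [_ []]. Qed.

Lemma theta0 : theta 0 = 0.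
Proof. exact: morphD0 thetaD. Qed.

Lemma theta_inj : injective theta.
Proof. by case: hform => _ [/bij_inj]. Qed.

Lemma theta_surj X : exists p, theta p = X.
Proof. by case: hform => _ [[g _ gK] _]; exists (g X). Qed.

Lemma theta_pure b s : theta (t b s) = s *: j b.
Proof. by case: hform => _ [_ [_ [thZ _]]]; rewrite -thZ mulr1. Qed.

Lemma thetaZ a p : theta (a *: p) = a%:A *: theta p.
Proof.
apply: (tensor_ind (Y := fun p => theta (a *: p) = a%:A *: theta p) tt).
- by rewrite scaler0 theta0 scaler0.
- by move=> x y ex ey; rewrite scalerDr !thetaD ex ey scalerDr.
move=> b s; rewrite -(is_linearZ (bilinear_lin_r b bt)) !theta_pure.
by rewrite scalerA mulr_algl.
Qed.

Lemma form_embP a x y : j (a *: x + y) = a%:A *: j x + j y.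
Proof. by rewrite /form_emb bt.1 thetaD thetaZ. Qed.

Lemma form_embM x y : j (x * y) = j x *m j y.
Proof. by case: hform => _ [_ [_ [_ [thM _]]]]; rewrite /form_emb -thM mulr1. Qed.

Lemma form_emb1 : j 1 = 1%:M.
Proof. by case: hform => _ [_ [_ [_ []]]]. Qed.

(** Surjectivity of [theta] as an induction principle: the image of [B] spans the matrices over [S],
    so additive and homogeneous identities need checking only on that image. *)
Lemma form_emb_span (Y : 'M[S]_n -> Prop) : Y 0 ->
  (forall X X', Y X -> Y X' -> Y (X + X')) -> (forall s b, Y (s *: j b)) ->
  forall X, Y X.
Proof.
move=> Y0 YD Yj X; have [p <-] := theta_surj X.
apply: (tensor_ind (Y := fun p => Y (theta p)) tt); first by rewrite theta0.
  by move=> x y; rewrite thetaD; apply: YD.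
by move=> b s; rewrite theta_pure.
Qed.

Lemma tensor_lift (Q : lmodType R) (g : B -> S -> Q) : is_bilinear g ->
  exists2 h : P -> Q, is_linear h & forall b s, h (t b s) = g b s.
Proof. by move=> bg; have [[h [lh hE]] _] := tt.2 _ _ bg; exists h. Qed.

Hypothesis hSff : faithfully_flat S.

(** The descent principle for [B], with bilinear maps replaced by linear maps out of [P]. Equalities
    in [P] can then be proved inside the matrix algebra by injectivity of [theta]. *)
Lemma form_span (X : B -> Prop) (v : B) :
  (forall (Q : lmodType R) (h : P -> Q), is_linear h ->
     (forall x, X x -> forall s, h (t x s) = 0) -> h (t v 1) = 0) ->
  in_Rspan X v.
Proof.
move=> vX; apply: (faithfully_flat_span hSff) => Q g bg gX.
have [h lh hE] := tensor_lift bg.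
by rewrite -hE; apply: vX => // x Xx s; rewrite hE gX.
Qed.

(** Descent for the zero submodule of [R]: moving [r] across a bilinear map gives
    [g r 1 = g 1 r%:A = 0]. *)
Lemma scalar_inj (r : R) : r%:A = 0 :> S -> r = 0.
Proof.
move=> r0; apply: (in_Rspan_ind (X := fun x : R^o => x = 0)
  (Y := fun x : R^o => x = 0)) => //.
  by move=> a u v -> ->; rewrite scaler0 addr0.
apply: (faithfully_flat_span hSff) => Q g bg _.
have <- : r *: (1 : R^o) = r by exact: mulr1.
rewrite (is_linearZ (bilinear_lin_l (1 : S) bg)).
rewrite -(is_linearZ (bilinear_lin_r (1 : R^o) bg)) r0.
exact: is_linear0 (bilinear_lin_r (1 : R^o) bg).
Qed.

Lemma form_emb_inj b : j b = 0 -> b = 0.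
Proof.
rewrite -theta0 => /theta_inj b0.
apply: (in_Rspan_ind (X := fun x => x = 0) (Y := fun x => x = 0)) => //.
  by move=> a u v -> ->; rewrite scaler0 addr0.
by apply: form_span => Q h lh _; rewrite b0 is_linear0.
Qed.

Lemma form_center (i0 : 'I_n) c :
  (forall x, c * x = x * c) -> exists r : R, c = r *: (1 : B).
Proof.
move=> cC; apply: (in_Rspan_ind (X := fun x => exists r : R, x = r *: (1 : B))
  (Y := fun x => exists r : R, x = r *: (1 : B))) => //.
- by exists 0; rewrite scale0r.
- by move=> a _ _ [r ->] [r' ->]; exists (a * r + r'); rewrite scalerDl scalerA.
apply: form_span => Q h lh hX.
have jC X : j c *m X = X *m j c.
  move: X; apply: form_emb_span => [|X X' eX eX'|s b].
  - by rewrite mulmx0 mul0mx.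
  - by rewrite mulmxDr mulmxDl eX eX'.
  - by rewrite -scalemxAr -scalemxAl -!form_embM cC.
(* Over [S] the central matrix [j c] is scalar, so [t c 1] is a multiple of the unit of [B] with
   coefficient in [S]; descent brings the coefficient into [R]. *)
have -> : t c 1 = t 1 (j c i0 i0); last by apply: hX; exists 1; rewrite scale1r.
apply: theta_inj; rewrite [RHS]theta_pure form_emb1 scalemx1.
exact: central_mx_scalar.
Qed.

Variable kappa : B -> B -> R.
Hypothesis bk : bilin_form kappa.
Hypothesis kE : forall b b', (kappa b b')%:A = \tr (j b *m j b').

Lemma kappa_eq x y x' y' :
  \tr (j x *m j y) = \tr (j x' *m j y') -> kappa x y = kappa x' y'.
Proof.
move=> e; apply/eqP; rewrite -subr_eq0; apply/eqP/scalar_inj.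
by rewrite scalerBl !kE e subrr.
Qed.

Lemma kappa_linl y : @is_linear R B R^o (kappa^~ y).
Proof. by move=> a u v; rewrite bk.1. Qed.

Lemma kappa_linr x : @is_linear R B R^o (kappa x).
Proof. by move=> a u v; rewrite bk.2. Qed.

Lemma kappa_assoc a b c : kappa (a * b) c = kappa a (b * c).
Proof. by apply: kappa_eq; rewrite !form_embM mulmxA. Qed.

Lemma kappa_sym a b : kappa a b = kappa b a.
Proof. by apply: kappa_eq; rewrite mxtrace_mulC. Qed.

Lemma kappa_invariant : invariant_form kappa.
Proof.
move=> a b c; rewrite kappa_assoc; split=> //.
by rewrite -kappa_assoc kappa_sym -kappa_assoc kappa_sym.
Qed.

(** Since the image of [B] spans, the matrix [j c] is orthogonal to every matrix for the trace form,
    and pairing with matrix units recovers its entries. *)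
Lemma kappa_nondeg c : (forall x, kappa c x = 0) -> c = 0.
Proof.
move=> c0; have jc X : \tr (j c *m X) = 0.
  move: X; apply: form_emb_span => [|X X' eX eX'|s b].
  - by rewrite mulmx0 mxtrace0.
  - by rewrite mulmxDr mxtraceD eX eX' addr0.
  - by rewrite -scalemxAr mxtraceZ -kE c0 scale0r mulr0.
apply: form_emb_inj; apply/matrixP => i k.
by rewrite -(mxtrace_delta_mul (j c) k i) mxtrace_mulC jc mxE.
Qed.

(** Over [S] a matrix is the sum of [\tr (delta_mx q p *m X) *: delta_mx p q]. Expanding both matrix
    units in the image of [B] turns the traces into values of [kappa]; the two coefficients from [S]
    are multiplied and carried by the second factor. *)
Lemma kappa_casimir : exists W : seq (B * B * S),
  forall x, t x 1 = \sum_(w <- W) kappa w.1.1 x *: t w.1.2 w.2.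
Proof.
pose cas (F : B -> 'M[S]_n) := exists W : seq (B * B * S),
  forall x, F x = theta (\sum_(w <- W) kappa w.1.1 x *: t w.1.2 w.2).
have cas0 F : (forall x, F x = 0) -> cas F.
  by move=> F0; exists [::] => x; rewrite big_nil theta0 F0.
have casD F F1 F2 : (forall x, F x = F1 x + F2 x) -> cas F1 -> cas F2 -> cas F.
  move=> FE [W1 e1] [W2 e2]; exists (W1 ++ W2) => x.
  by rewrite big_cat thetaD -e1 -e2.
have casYZ Y Z : cas (fun x => \tr (Y *m j x) *: Z).
  move: Y; apply: form_emb_span => [|Y Y' cY cY'|s b].
  - by apply: cas0 => x; rewrite mul0mx mxtrace0 scale0r.
  - by apply: casD cY cY' => x; rewrite mulmxDl mxtraceD scalerDl.
  move: Z; apply: form_emb_span => [|Y Y' cY cY'|s' b'].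
  - by apply: cas0 => x; rewrite scaler0.
  - by apply: casD cY cY' => x; rewrite scalerDr.
  exists [:: ((b, b'), s * s')] => x; rewrite big_seq1 /= thetaZ theta_pure.
  rewrite -scalemxAl mxtraceZ -kE !scalerA; congr (_ *: _).
  by rewrite -mulrA mulrCA mulrA.
have cas_sum I (r : seq I) (F : I -> B -> 'M[S]_n) :
    (forall i, cas (F i)) -> cas (fun x => \sum_(i <- r) F i x).
  move=> cF; elim: r => [|i r IH]; first by apply: cas0 => x; rewrite big_nil.
  by apply: casD (cF i) IH => x; rewrite big_cons.
have [W WE] := cas_sum _ (index_enum 'I_n) _ (fun p => cas_sum _ (index_enum 'I_n) _
  (fun q => casYZ (delta_mx q p) (delta_mx p q))).
exists W => x; apply: theta_inj; rewrite -WE -/(form_emb x) {1}[j x]matrix_sum_delta.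
by apply: eq_bigr => p _; apply: eq_bigr => q _; rewrite mxtrace_delta_mul.
Qed.

(** The [c i] of the Casimir sum generate [B], so it suffices to solve
    [c l = \sum_i kappa (b i) (c l) *: y i] for all [l] at once. This is a finite linear system with
    coefficients in [R], solved over [S] by the tensors [t (c i) (s i)]; solvability means that the
    tuple [v] lies in the submodule [X], and this descends. *)
Lemma kappa_dual_basis : exists m (b c : 'I_m -> B),
  forall x, x = \sum_i kappa (b i) x *: c i.
Proof.
have [W WE] := kappa_casimir; pose m := size W.
pose w (i : 'I_m) := tnth (in_tuple W) i.
pose b i := (w i).1.1; pose c i := (w i).1.2; pose s i := (w i).2.
have {}WE x : t x 1 = \sum_i kappa (b i) x *: t (c i) (s i) by rewrite WE big_tnth.
have cB x : in_Rspan (fun y => exists i, y = c i) x.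
  apply: form_span => Q h lh hX; rewrite WE is_linear_sum // big1 // => i _.
  by rewrite is_linearZ // hX ?scaler0 //; exists i.
pose N : lmodType R := {ffun 'I_m -> B}.
pose X (u : N) := exists y : 'I_m -> B, forall l, u l = \sum_i kappa (b i) (c l) *: y i.
pose v : N := [ffun l => c l].
suff [y yE] : X v.
  exists m, b, y => x.
  apply: (in_Rspan_ind (Y := fun x => x = \sum_i kappa (b i) x *: y i) _ _ _ (cB x)).
  - by rewrite big1 // => i _; rewrite (is_linear0 (kappa_linr _)) scale0r.
  - move=> a u u' eu eu'; rewrite {1}eu {1}eu' scaler_sumr -big_split.
    by apply: eq_bigr => i _; rewrite bk.2 scalerDl scalerA.
  - by move=> _ [l ->]; rewrite -yE ffunE.
apply: (@in_Rspan_ind _ _ X).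
- by exists (fun=> 0) => l; rewrite ffunE big1 // => i _; rewrite scaler0.
- move=> a u u' [y yE] [y' yE']; exists (fun i => a *: y i + y' i) => l.
  rewrite !ffunE yE yE' scaler_sumr -big_split; apply: eq_bigr => i _.
  by rewrite scalerDr !scalerA [a * _]mulrC.
- by [].
apply: (faithfully_flat_span hSff) => Q g bg gX.
pose e (l : 'I_m) (x : B) : N := [ffun l' => if l' == l then x else 0].
have le l : is_linear (e l).
  move=> a x y; apply/ffunP => l'; rewrite !ffunE.
  by case: eqP; rewrite ?scaler0 ?addr0.
have ge l : g (e l (c l)) 1 = \sum_i kappa (b i) (c l) *: g (e l (c i)) (s i).
  have bge : is_bilinear (fun x s => g (e l x) s).
    apply: is_bilinearP => [s' a x y | x]; last exact: bilinear_lin_r bg.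
    by rewrite le (bilinear_lin_l s' bg).
  have [h lh hE] := tensor_lift bge.
  rewrite -hE WE is_linear_sum //; apply: eq_bigr => i _.
  by rewrite is_linearZ // hE.
have -> : v = \sum_l e l (c l).
  apply/ffunP => l; rewrite sum_ffunE ffunE (bigD1 l) //= big1 ?addr0 => [|l' nl].
    by rewrite ffunE eqxx.
  by rewrite ffunE eq_sym (negPf nl).
rewrite (is_linear_sum (bilinear_lin_l (1 : S) bg)) (eq_bigr _ (fun l _ => ge l)).
rewrite exchange_big big1 // => i _.
transitivity (g (\sum_l kappa (b i) (c l) *: e l (c i)) (s i)).
  rewrite (is_linear_sum (bilinear_lin_l (s i) bg)); apply: eq_bigr => l _.
  by rewrite (is_linearZ (bilinear_lin_l (s i) bg)).
(* After exchanging the sums, the part with fixed [i] is the image of the family equal to [c i] at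
   [i] and 0 elsewhere; it lies in [X], so [g] kills it. *)
apply: gX; exists (fun i' => if i' == i then c i else 0) => l.
rewrite sum_ffunE (bigD1 l) //= big1 ?addr0 => [|l' nl]; last first.
  by rewrite !ffunE eq_sym (negPf nl) scaler0.
rewrite [RHS](bigD1 i) //= big1 ?addr0 => [|i' ni]; last first.
  by rewrite (negPf ni) scaler0.
by rewrite !ffunE !eqxx.
Qed.

Lemma kappa_nonsingular : nonsingular_form kappa.
Proof.
split=> [c c' e | f lf].
  apply/eqP; rewrite -subr_eq0; apply/eqP/kappa_nondeg => x.
  by rewrite addrC -scaleN1r bk.1 e mulN1r addNr.
have {}lf : @is_linear R B R^o f by [].
have [m [b [c bcE]]] := kappa_dual_basis.
(* Apply [f] to the dual basis expansion of [x]. *)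
exists (\sum_i f (c i) *: b i) => x.
rewrite (is_linear_sum (kappa_linl x)) {2}[x]bcE (is_linear_sum lf).
apply: eq_bigr => i _; rewrite (is_linearZ (kappa_linl x)) (is_linearZ lf).
exact: mulrC.
Qed.

(** An invariant form is determined by the functional [beta 1], which is symmetric on products. The
    element [c] representing it through [kappa] is therefore central, hence a scalar from [R]. *)
Lemma kappa_basis (i0 : 'I_n) beta : bilin_form beta -> invariant_form beta ->
  exists r : R, forall a b, beta a b = kappa (r *: a) b.
Proof.
move=> bb ib.
have b1 a b : beta a b = beta 1 (a * b) by rewrite -(ib 1 a b).1 mul1r.
have bC a b : beta 1 (a * b) = beta 1 (b * a).
  by rewrite -!b1 -{1}[a]mulr1 (ib a 1 b).1 -[a in LHS]mulr1 (ib a 1 _).2 -b1 mul1r.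
have [c cE] := kappa_nonsingular.2 (beta 1) (fun a x y => bb.2 a x y 1).
have [x|r cr] := form_center i0 (c := c).
  apply: kappa_nonsingular.1 => y; rewrite kappa_assoc cE bC -cE.
  by rewrite [RHS]kappa_sym -[RHS]kappa_assoc [RHS]kappa_sym.
exists r => a b; rewrite b1 -cE cr.
by rewrite (is_linearZ (kappa_linl _)) -kappa_assoc mul1r (is_linearZ (kappa_linl _)).
Qed.

Lemma kappa_basis_free (i0 : 'I_n) r : (forall a b, kappa (r *: a) b = 0) -> r = 0.
Proof.
move=> r0; apply: scalar_inj.
have /(congr1 j) := kappa_nondeg (r0 1).
have -> : r *: 1 = r *: 1 + 0 :> B by rewrite addr0.
rewrite form_embP /form_emb (is_linear0 (bilinear_lin_l (1 : S) bt)) theta0 addr0.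
rewrite -/(form_emb 1) form_emb1 => /matrixP/(_ i0 i0).
by rewrite !mxE eqxx mulr1.
Qed.

(** The values of [kappa 1] form an ideal of [R]; it contains 1 by descent, because over [S] a
    diagonal matrix unit has trace 1. *)
Lemma kappa1_surj (i0 : 'I_n) r : exists b, kappa 1 b = r.
Proof.
suff [b kb] : exists b, kappa 1 b = 1.
  by exists (r *: b); rewrite (is_linearZ (kappa_linr _)) kb; apply: mulr1.
pose X (x : R^o) := exists b, kappa 1 b = x.
apply: (in_Rspan_ind (X := X) (Y := X) _ _ _ (x := 1)) => //.
- by exists 0; rewrite (is_linear0 (kappa_linr _)).
- by move=> a _ _ [b <-] [b' <-]; exists (a *: b + b'); rewrite (kappa_linr _).
apply: (faithfully_flat_span hSff) => Q g bg gX.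
have bgk : is_bilinear (fun b s => g (kappa 1 b) s).
  apply: is_bilinearP => [s a x y | b]; last exact: bilinear_lin_r bg.
  by rewrite (kappa_linr _) (bilinear_lin_l s bg).
have [h lh hE] := tensor_lift bgk.
have g1 := bilinear_lin_r (1 : R^o) bg.
have hg p : h p = g 1 (\tr (theta p)).
  move: p; apply: (tensor_ind (Y := fun p => h p = g 1 (\tr (theta p))) tt) =>
    [|p q ep eq|b s].
  - by rewrite is_linear0 // theta0 mxtrace0 is_linear0.
  - by rewrite is_linearD // ep eq thetaD mxtraceD is_linearD.
  rewrite hE theta_pure mxtraceZ -[j b]mul1mx -form_emb1 -kE mulr_algr is_linearZ //.
  by rewrite -(is_linearZ (bilinear_lin_l s bg)) [_ *: _]mulr1.
have [p pE] := theta_surj (delta_mx i0 i0).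
have <- : \tr (theta p) = 1.
  by rewrite pE -[delta_mx _ _]mulmx1 mxtrace_delta_mul mxE eqxx.
rewrite -hg; move: p {pE}; apply: (tensor_ind (Y := fun p => h p = 0) tt) =>
  [|p q ep eq|b s].
- exact: is_linear0.
- by rewrite is_linearD // ep eq addr0.
- by rewrite hE gX //; exists b.
Qed.

(** A map [h] killing commutators of [B] tensored with [S] becomes, through the inverse of [theta],
    an additive map on matrices invariant under swapping factors. It vanishes on trace zero
    matrices, in particular on [j b]. *)
Lemma kappa1_ker b :
  kappa 1 b = 0 -> in_Rspan (fun x => exists a c, x = a * c - c * a) b.
Proof.
move=> kb; apply: form_span => Q h lh hX.
have [_ [[gam thK gamK] _]] := hform.
have gamD : {morph gam : X Y / X + Y}.
  by move=> X Y; apply: theta_inj; rewrite thetaD !gamK.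
rewrite -[t b 1]thK; pose H X := h (gam X).
apply: (mxtrace_universal (H := H)); first 1 last.
- move=> X Y; rewrite -[X]gamK -[Y]gamK; move: (gam X) (gam Y) => p q {X Y}.
  have H0 : H 0 = 0 by rewrite /H -theta0 thK is_linear0.
  have HD X Y : H (X + Y) = H X + H Y by rewrite /H gamD is_linearD.
  move: p; apply: (tensor_ind (Y := fun p =>
      H (theta p *m theta q) = H (theta q *m theta p)) tt) => [|p p' ep ep'|x s].
  - by rewrite theta0 mul0mx mulmx0.
  - by rewrite thetaD mulmxDl mulmxDr !HD ep ep'.
  move: q; apply: (tensor_ind (Y := fun q => H (theta (t x s) *m theta q) =
      H (theta q *m theta (t x s))) tt) => [|p p' ep ep'|x' s'].
  - by rewrite theta0 mul0mx mulmx0.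
  - by rewrite thetaD mulmxDl mulmxDr !HD ep ep'.
  have [_ [_ [_ [_ [thM _]]]]] := hform.
  rewrite -!thM /H !thK [s' * s]mulrC; apply/eqP; rewrite -subr_eq0 -scaleN1r addrC.
  rewrite -lh -(bilinear_lin_l _ bt) scaleN1r addrC; apply/eqP/hX.
  by exists x, x'.
- by rewrite -[theta _]mul1mx -form_emb1 -kE kb scale0r.
- by move=> X Y; rewrite /H gamD is_linearD.
Qed.

(** Associators vanish in [B], and a multiple of a commutator is a commutator with one entry
    rescaled, so the additive span is already an [R]-submodule. *)
Lemma kappa1_ac b : kappa 1 b = 0 <-> in_addspan (@ac_generators R B) b.
Proof.
split=> [/kappa1_ker | bac].
  apply: (in_Rspan_ind (Y := in_addspan (@ac_generators R B))) =>
    [|a u v ac_u ac_v|_ [x [y ->]]].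
  - by move=> Q Q0.
  - have ac_au : in_addspan (@ac_generators R B) (a *: u).
      apply: (ac_u (fun u => in_addspan (@ac_generators R B) (a *: u))).
      + by rewrite scaler0 => Q.
      + move=> x y ax ay Q Q0 QB QX; rewrite scalerBr.
        exact: QB (ax Q Q0 QB QX) (ay Q Q0 QB QX).
      move=> x [[x1 [x2 [x3 ->]]] | [x1 [x2 ->]]] Q Q0 QB QX.
        by rewrite mulrA subrr scaler0.
      apply: (QX); right; exists (a *: x1), x2.
      by rewrite scalerBr scalerAl scalerAr.
    move=> Q Q0 QB QX; rewrite -[v]opprK -[- v]sub0r.
    exact: QB (ac_au Q Q0 QB QX) (QB _ _ Q0 (ac_v Q Q0 QB QX)).
  - by move=> Q Q0 QB QX; apply: (QX); right; exists x, y.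
have kB := is_linearB (kappa_linr 1).
apply: (bac (fun b => kappa 1 b = 0)) => [|u v eu ev|_ [[x [y [z ->]]] | [x [y ->]]]].
- exact: is_linear0 (kappa_linr _).
- by rewrite kB eu ev subrr.
- by rewrite mulrA subrr; apply: is_linear0 (kappa_linr _).
- by rewrite kB -!kappa_assoc !mul1r kappa_sym subrr.
Qed.

Lemma kappa_ibf (i0 : 'I_n) (Q : lmodType R) (tB : B -> B -> Q) (g : Q -> R) :
  is_tensor tB -> (forall (a : R) x y, g (a *: x + y) = a * g x + g y) ->
  (forall b b', g (tB b b') = kappa b b') ->
  (forall r : R, exists q, g q = r) /\
  (forall q, g q = 0 <-> in_Rspan (ibf_relations tB) q).
Proof.
move=> ttB lg gE; have {}lg : @is_linear R Q R^o g by [].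
have gB := is_linearB lg.
split=> [r | q]; first by have [b <-] := kappa1_surj i0 r; exists (tB 1 b).
split=> [gq | qX]; last first.
  apply: (in_Rspan_ind (Y := fun q => g q = 0) _ _ _ qX) =>
    [|a u v eu ev|_ [x [y [z [->|->]]]]].
  - exact: is_linear0 lg.
  - by rewrite lg eu ev scaler0 addr0.
  - by rewrite gB !gE (kappa_invariant x y z).1 subrr.
  - by rewrite gB !gE (kappa_invariant x y z).2 subrr.
have tB1 := bilinear_lin_r (1 : B) ttB.1.
(* Modulo the relations [tB b c] becomes [tB 1 (b * c)], which reduces the kernel of [g] to that of
   [kappa 1]. *)
have q1 : exists y, in_Rspan (ibf_relations tB) (q - tB 1 y).
  move: q {gq}; apply: (tensor_ind (Y := fun q =>
      exists y, in_Rspan (ibf_relations tB) (q - tB 1 y)) ttB) =>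
    [|p q [y py] [z qz]|b c].
  - by exists 0; rewrite (is_linear0 tB1) subrr; apply: in_Rspan0.
  - exists (y + z); rewrite (is_linearD tB1) opprD addrACA.
    exact: in_RspanD.
  - exists (b * c); apply: in_Rspan_gen; exists 1, b, c; left.
    by rewrite mul1r.
have [y qy] := q1; rewrite -[q](subrK (tB 1 y)); apply: in_RspanD => //.
have : in_Rspan (fun x => exists a c, x = a * c - c * a) y.
  apply: kappa1_ker; rewrite -gE -[tB 1 y](subKr q) gB gq sub0r.
  have -> : g (q - tB 1 y) = 0; last by rewrite oppr0.
  apply: (in_Rspan_ind (Y := fun q => g q = 0) _ _ _ qy) =>
    [|a u v eu ev|_ [a [b [c [->|->]]]]].
  - exact: is_linear0 lg.
  - by rewrite lg eu ev scaler0 addr0.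
  - by rewrite gB !gE (kappa_invariant a b c).1 subrr.
  - by rewrite gB !gE (kappa_invariant a b c).2 subrr.
apply: (in_Rspan_ind (Y := fun y => in_Rspan (ibf_relations tB) (tB 1 y))) =>
  [|a u v eu ev|_ [a [c ->]]].
- by rewrite (is_linear0 tB1); apply: in_Rspan0.
- by rewrite tB1; apply: in_RspanP.
(* Difference of the second relation at (a, 1, c) and the first at (1, a, c). *)
have -> : tB 1 (a * c - c * a) =
    (tB (a * 1) c - tB 1 (c * a)) - (tB (1 * a) c - tB 1 (a * c)).
  rewrite mulr1 mul1r opprB [RHS]addrC subrKA.
  exact: is_linearB.
apply: in_RspanD; last apply: in_RspanN.
  by apply: in_Rspan_gen; exists a, 1, c; right.
by apply: in_Rspan_gen; exists 1, a, c; left.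
Qed.

End Form.

(** * The canonical maps into the tensor product of algebras *)

Section TensorEmbeddings.
Variables (R : comPzRingType) (T S : comAlgType R).

Let bp := tens_pure_bilinear T S.

Definition tens_inl (a : T) : tens T S := tens_pure a 1.
Definition tens_inr (s : S) : tens T S := tens_pure 1 s.

Fact tens_inl_is_zmod : zmod_morphism tens_inl.
Proof. exact: is_linearB (bilinear_lin_l (1 : S) bp). Qed.

Fact tens_inl_is_monoid : monoid_morphism tens_inl.
Proof. by split=> // x y; rewrite /tens_inl tens_pureM mulr1. Qed.

Fact tens_inr_is_zmod : zmod_morphism tens_inr.
Proof. exact: is_linearB (bilinear_lin_r (1 : T) bp). Qed.

Fact tens_inr_is_monoid : monoid_morphism tens_inr.
Proof. by split=> // x y; rewrite /tens_inr tens_pureM mulr1. Qed.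

HB.instance Definition _ := GRing.isZmodMorphism.Build T (tens T S) tens_inl
  tens_inl_is_zmod.
HB.instance Definition _ := GRing.isMonoidMorphism.Build T (tens T S) tens_inl
  tens_inl_is_monoid.
HB.instance Definition _ := GRing.isZmodMorphism.Build S (tens T S) tens_inr
  tens_inr_is_zmod.
HB.instance Definition _ := GRing.isMonoidMorphism.Build S (tens T S) tens_inr
  tens_inr_is_monoid.

Lemma tens_pureE a s : tens_pure a s = tens_inl a * tens_inr s.
Proof. by rewrite tens_pureM mulr1 mul1r. Qed.

Lemma tens_scalarE (r : R) : tens_inr r%:A = tens_inl r%:A.
Proof.
rewrite /tens_inr (is_linearZ (bilinear_lin_r (1 : T) bp)).
by rewrite -(is_linearZ (bilinear_lin_l (1 : S) bp)).
Qed.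

Lemma tens_inl_inj : faithfully_flat S -> injective tens_inl.
Proof.
move=> hS x y exy; apply/eqP; rewrite -subr_eq0; apply/eqP.
apply: (in_Rspan_ind (X := fun x : T => x = 0) (Y := fun x : T => x = 0)) => //.
  by move=> a u v -> ->; rewrite scaler0 addr0.
apply: (faithfully_flat_span hS) => Q g bg _.
rewrite -(tens_lift_pure _ _ bg) -/(tens_inl _) rmorphB /= exy subrr.
exact: is_linear0 (tens_lift_linear bg).
Qed.

End TensorEmbeddings.

(** The universal property is applied to the [R]-module of families of entries, and the result is
    reassembled into a matrix. *)
Lemma tensor_lift_mx (R : comPzRingType) (M N P : lmodType R) (t : M -> N -> P)
    n (A : lmodType R) (g : M -> N -> 'M[A]_n) :
  is_tensor t -> (forall i k, is_bilinear (fun x y => g x y i k)) ->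
  exists2 h : P -> 'M[A]_n, {morph h : p q / p + q} & forall x y, h (t x y) = g x y.
Proof.
move=> tt bg; pose Q : lmodType R := {ffun 'I_n * 'I_n -> A}.
pose g' x y : Q := [ffun ik => g x y ik.1 ik.2].
have bg' : is_bilinear g'.
  split=> [y a x1 x2|x a y1 y2]; apply/ffunP => ik; rewrite !ffunE.
    exact: (bg _ _).1.
  exact: (bg _ _).2.
have [[h [lh hE]] _] := tt.2 _ _ bg'.
exists (fun p => \matrix_(i, k) h p (i, k)) => [p q | x y]; apply/matrixP => i k.
  by rewrite !mxE is_linearD // ffunE.
by rewrite mxE hE ffunE.
Qed.

(** * Invariance under automorphisms *)

Section FormAut.
Variables (R : comPzRingType) (S : comAlgType R) (n : nat) (B : algType R).
Variables (P : lmodType R) (t : B -> S -> P) (theta : P -> 'M[S]_n).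
Hypothesis hform : alg_tensor_iso t theta.
Variables (T : comAlgType R) (PT : lmodType R) (tT : B -> T -> PT).
Hypothesis ttT : is_tensor tT.
Variables (act : T -> PT -> PT) (mul : PT -> PT -> PT).
Hypotheses (hact : tensor_act tT act) (hmul : tensor_mul tT mul).

Local Notation j := (form_emb t theta).
Local Notation A := (tens T S).
Local Notation inl := (@tens_inl R T S).
Local Notation inr := (@tens_inr R T S).
Local Notation jA b := (map_mx inr (j b)).

Let tt : is_tensor t := hform.1.

Lemma form_emb_linear i k : is_linear (fun b => j b i k).
Proof. by move=> a x y; rewrite form_embP // !mxE mulr_algl. Qed.

Lemma act0 a : act a 0 = 0.
Proof. exact: morphD0 (hact.1 a). Qed.

Lemma act_scalar r p : act r%:A p = r *: p.
Proof.
move: p; apply: (tensor_ind (Y := fun p => act r%:A p = r *: p) ttT).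
- by rewrite act0 scaler0.
- by move=> p q ep eq; rewrite hact.1 ep eq scalerDr.
by move=> b s; rewrite hact.2 mulr_algl (is_linearZ (bilinear_lin_r b ttT.1)).
Qed.

(* B (x) T (x) S is M_n(T (x) S), and [u] is the map x |-> x (x) 1 into it. *)
Lemma base_change_emb : exists u : PT -> 'M[A]_n,
  [/\ {morph u : p q / p + q}, forall b a, u (tT b a) = inl a *: jA b,
      forall a p, u (act a p) = inl a *: u p &
      forall p q, u (mul p q) = u p *m u q].
Proof.
have bp := tens_pure_bilinear T S.
have [|u uD uE] := @tensor_lift_mx _ _ _ _ tT n A (fun b a => inl a *: jA b) ttT.
  move=> i k; split=> [a r x y|b r x y]; rewrite !mxE -!tens_pureE.
    by rewrite form_emb_linear (bilinear_lin_r a bp).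
  by rewrite (bilinear_lin_l _ bp).
have u0 := morphD0 uD.
have uact a p : u (act a p) = inl a *: u p.
  move: p; apply: (tensor_ind (Y := fun p => u (act a p) = inl a *: u p) ttT).
  - by rewrite act0 u0 scaler0.
  - by move=> p q ep eq; rewrite hact.1 !uD ep eq scalerDr.
  by move=> b s; rewrite hact.2 !uE rmorphM scalerA.
exists u; split=> // p q; have [mDl [mDr mE]] := hmul.
have mul0 p' := morphD0 (mDr p').
have mul0' p' := morphD0 (fun x y => mDl x y p').
move: p; apply: (tensor_ind (Y := fun p => u (mul p q) = u p *m u q) ttT).
- by rewrite mul0' u0 mul0mx.
- by move=> p p' ep ep'; rewrite mDl !uD ep ep' mulmxDl.
move=> b s; move: q.
apply: (tensor_ind (Y := fun q => u (mul (tT b s) q) = u (tT b s) *m u q) ttT).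
- by rewrite mul0 u0 mulmx0.
- by move=> p p' ep ep'; rewrite mDr !uD ep ep' mulmxDr.
move=> b' s'; rewrite mE !uE form_embM // map_mxM rmorphM /=.
by rewrite -scalemxAl -scalemxAr scalerA.
Qed.

Lemma base_change_span (Y : 'M[A]_n -> Prop) : Y 0 ->
  (forall X X', Y X -> Y X' -> Y (X + X')) -> (forall a b, Y (a *: jA b)) ->
  forall X, Y X.
Proof.
move=> Y0 YD Yj X; rewrite [X]matrix_sum_delta.
apply: big_ind => // i _; apply: big_ind => // k _.
rewrite -(map_delta_mx inr); move: (X i k) => {X} a.
move: (delta_mx i k).
apply: (form_emb_span hform (Y := fun M => Y (a *: map_mx inr M))).
- by rewrite map_mx0 scaler0.
- by move=> M M' YM YM'; rewrite map_mxD scalerDr; apply: YD.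
- by move=> s b; rewrite map_mxZ scalerA.
Qed.

(** [F] is built in two steps: [Phi] sends [t b s] to [inr s *: u (f (tT b 1))], and its transport
    along [theta] is extended linearly over [tens T S] by its values on matrix units. Only linearity
    of [f] over [T] is assumed, so the lemma serves for an automorphism and for its inverse
    alike. *)
Lemma base_change_extend (u : PT -> 'M[A]_n) (f : PT -> PT) :
  {morph u : p q / p + q} -> (forall b a, u (tT b a) = inl a *: jA b) ->
  (forall a p, u (act a p) = inl a *: u p) ->
  {morph f : p q / p + q} -> (forall a p, f (act a p) = act a (f p)) ->
  exists2 F : 'M[A]_n -> 'M[A]_n, is_linear F & forall p, F (u p) = u (f p).
Proof.
move=> uD uE uact fD fact.
have bp := tens_pure_bilinear T S.
have fr : forall r p, f (r *: p) = r *: f p by move=> r p; rewrite -!act_scalar fact.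
have ur r p : u (r *: p) = inl r%:A *: u p by rewrite -act_scalar uact.
have [|Phi PhiD PhiE] :=
  @tensor_lift_mx _ _ _ _ t n A (fun b s => inr s *: u (f (tT b 1))) tt.
  have inlM r (x : A) : inl r%:A * x = r *: x.
    have -> : inl r%:A = r *: (1 : A).
      by rewrite /inl (is_linearZ (bilinear_lin_l (1 : S) bp)).
    by apply: etrans (is_linearZ (tens_mul_linl x) r 1) _; congr (_ *: _); apply: mul1r.
  move=> i k; split=> [s r x y|b r x y]; rewrite !mxE.
    rewrite ttT.1.1 fD fr uD ur !mxE inlM mulrDr; congr (_ + _).
    by rewrite mulrC [LHS](is_linearZ (tens_mul_linl _)) mulrC.
  rewrite -[r *: x]mulr_algl rmorphD rmorphM mulrDl -mulrA /=.
  by rewrite tens_scalarE inlM.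
have Phi0 := morphD0 PhiD.
have [_ [[gam thK gamK] [_ [thZ _]]]] := hform.
have gamD : {morph gam : X Y / X + Y}.
  by move=> X Y; apply: (theta_inj hform); rewrite (thetaD hform) !gamK.
have gam0 := morphD0 gamD.
pose H X := Phi (gam X).
have HD : {morph H : X Y / X + Y} by move=> X Y; rewrite /H gamD PhiD.
have H0 : H 0 = 0 by rewrite /H gam0.
have HZ s X : H (s *: X) = inr s *: H X.
  rewrite -[X]gamK; move: (gam X) => p {X}.
  move: p; apply: (tensor_ind (Y := fun p =>
      H (s *: theta p) = inr s *: H (theta p)) tt).
  - by rewrite (theta0 hform) scaler0 H0 scaler0.
  - by move=> p q ep eq; rewrite (thetaD hform) scalerDr !HD ep eq scalerDr.
  by move=> b s'; rewrite -thZ /H !thK !PhiE rmorphM scalerA.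
pose F (X : 'M[A]_n) := \sum_i \sum_k X i k *: H (delta_mx i k).
have lF : is_linear F.
  move=> a X Y; rewrite /F scaler_sumr -big_split; apply: eq_bigr => i _ /=.
  rewrite scaler_sumr -big_split; apply: eq_bigr => k _ /=.
  by rewrite !mxE scalerDl scalerA.
have Fmap X : F (map_mx inr X) = H X.
  rewrite {2}[X]matrix_sum_delta (big_morph H HD H0); apply: eq_bigr => i _.
  by rewrite (big_morph H HD H0); apply: eq_bigr => k _; rewrite HZ mxE.
exists F => // p.
move: p; apply: (tensor_ind (Y := fun p => F (u p) = u (f p)) ttT).
- have u0 := morphD0 uD.
  have f0 := morphD0 fD.
  by rewrite f0 u0 is_linear0.
- by move=> p q ep eq; rewrite uD fD uD is_linearD // ep eq.
move=> b a; rewrite uE is_linearZ // Fmap /H thK PhiE rmorph1 scale1r -uact.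
by rewrite -fact hact.2 mulr1.
Qed.

End FormAut.

Lemma kappa_Aut_invariant (R : comPzRingType) (S : comAlgType R) n (B : algType R)
    (P : lmodType R) (t : B -> S -> P) (theta : P -> 'M[S]_n) (kappa : B -> B -> R) :
  alg_tensor_iso t theta -> faithfully_flat S ->
  (forall b b', (kappa b b')%:A = \tr (form_emb t theta b *m form_emb t theta b')) ->
  Aut_invariant_form kappa.
Proof.
move=> hform hS kE T PT tT act mul kT ttT hact hmul [kDl [kDr kTE]] f [g fK gK].
move=> fD fact fmul _ p q.
have [u [uD uE uact umul]] := base_change_emb hform ttT hact hmul.
have gD : {morph g : p q / p + q} by move=> x y; apply: (can_inj fK); rewrite fD !gK.
have gact a x : g (act a x) = act a (g x) by apply: (can_inj fK); rewrite fact !gK.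
have [F lF FE] := base_change_extend hform ttT hact uD uE uact fD fact.
have [G lG GE] := base_change_extend hform ttT hact uD uE uact gD gact.
have uj b : map_mx (@tens_inr R T S) (form_emb t theta b) = u (tT b 1).
  by rewrite uE rmorph1 scale1r.
have span := base_change_span hform (T := T).
have inv F1 F2 : is_linear F1 -> is_linear F2 -> (forall x, F2 (F1 (u x)) = u x) ->
    cancel F1 F2.
  move=> l1 l2 F12; apply: (span (fun X => F2 (F1 X) = X)) => [|X X' eX eX'|a b].
  - by rewrite !is_linear0.
  - by rewrite !is_linearD // eX eX'.
  - by rewrite !is_linearZ // uj F12.
have bijF : bijective F.
  exists G; apply: inv => // x; first by rewrite FE GE fK.
  by rewrite GE FE gK.
have FM X Y : F (X *m Y) = F X *m F Y.
  move: X; apply: (span (fun X => F (X *m Y) = F X *m F Y)) => [|X X' eX eX'|a b].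
  - by rewrite mul0mx is_linear0 // mul0mx.
  - by rewrite mulmxDl !is_linearD // mulmxDl eX eX'.
  move: Y; apply: (span (fun Y => F (a *: _ *m Y) = F (a *: _) *m F Y)) =>
    [|X X' eX eX'|a' b'].
  - by rewrite mulmx0 is_linear0 // mulmx0.
  - by rewrite mulmxDr [F (X + X')]is_linearD // is_linearD // mulmxDr eX eX'.
  rewrite -scalemxAl -scalemxAr !(is_linearZ lF) -scalemxAl -scalemxAr.
  by rewrite !uj -umul !FE fmul umul.
(* The trace form on the large matrix algebra restricts to [kT], with values in the image of [T]; as
   [tens_inl] is injective, invariance may be checked there. *)
have trk x y : \tr (u x *m u y) = tens_inl S (kT x y).
  have k0l z := morphD0 (fun x y => kDl x y z).
  have k0r z := morphD0 (kDr z).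
  have u0 := morphD0 uD.
  move: x; apply: (tensor_ind (Y := fun x =>
    \tr (u x *m u y) = tens_inl S (kT x y)) ttT).
  - by rewrite u0 mul0mx mxtrace0 k0l rmorph0.
  - by move=> x x' ex ex'; rewrite uD mulmxDl mxtraceD ex ex' kDl rmorphD.
  move=> b a; move: y; apply: (tensor_ind
    (Y := fun y => \tr (u (tT b a) *m u y) = tens_inl S (kT (tT b a) y)) ttT).
  - by rewrite u0 mulmx0 mxtrace0 k0r rmorph0.
  - by move=> x x' ex ex'; rewrite uD mulmxDr mxtraceD ex ex' kDr rmorphD.
  move=> b' a'; rewrite !uE -scalemxAl -scalemxAr -map_mxM !mxtraceZ trace_map_mx /=.
  by rewrite -kE tens_scalarE -!rmorphM kTE /= mulrA mulrC.
apply: (tens_inl_inj hS); rewrite -!trk -!FE -FM.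
exact: mxtrace_automorphism.
Qed.

Theorem theorem6p10
  (k : comPzRingType) (R : comAlgType k) (hRflat : flat R)
  (S : comAlgType R) (hSff : faithfully_flat S)
  (n : nat) (hn : (0 < n)%N)
  (B : algType R)
  (P : lmodType R) (t : B -> S -> P) (theta : P -> 'M[S]_n)
  (hform : alg_tensor_iso t theta)
  (kappa : B -> B -> R) (hkappa : is_kappa n kappa) :
  (* (a) *)
  (nonsingular_form kappa /\ invariant_form kappa /\ Aut_invariant_form kappa /\
   (forall beta : B -> B -> R, bilin_form beta -> invariant_form beta ->
      exists r : R, forall a b, beta a b = kappa (r *: a) b) /\
   (forall r : R, (forall a b, kappa (r *: a) b = 0) -> r = 0)) /\
  (* (b) *)
  ((forall (Q : lmodType R) (tB : B -> B -> Q) (g : Q -> R),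
      is_tensor tB ->
      (forall (a : R) x y, g (a *: x + y) = a * g x + g y) ->
      (forall b b', g (tB b b') = kappa b b') ->
      (forall r : R, exists q, g q = r) /\
      (forall q, g q = 0 <-> in_Rspan (ibf_relations tB) q)) /\
   (exists g : B -> R,
      (forall (a : R) x y, g (a *: x + y) = a * g x + g y) /\
      (forall r : R, exists b, g b = r) /\
      (forall b, g b = 0 <-> in_addspan (@ac_generators R B) b))) /\
  (* (c) *)
  (forall b b' : B, (kappa b b')%:A = \tr (theta (t b 1) *m theta (t b' 1))).
Proof.
have [bk hk] := hkappa.
(* Part (c) is the characterising property at [s = s' = 1]; the other parts are deduced from it. *)
have kE b b' : (kappa b b')%:A = \tr (theta (t b 1) *m theta (t b' 1)).
  by rewrite -(hk S hSff P t theta hform) !mulr1.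
pose i0 := Ordinal hn.
split; [|split; [split|]] => //.
- split; first exact: kappa_nonsingular hform hSff kappa bk kE.
  split; first exact: kappa_invariant hform hSff kappa kE.
  split; first exact: kappa_Aut_invariant hform hSff kE.
  split; first exact: kappa_basis hform hSff kappa bk kE i0.
  exact: kappa_basis_free hform hSff kappa kE i0.
- exact: kappa_ibf hform hSff kappa bk kE i0.
exists (kappa 1); split; first by move=> a x y; apply: bk.2.
split; first exact: kappa1_surj hform hSff kappa bk kE i0.
exact: kappa1_ac hform hSff kappa bk kE.
Qed.
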